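(* Let $R$ be a finite chain ring, $0<k<n$ integers, and $a(x)\in B_k$. The $n$-equivalence class of $a(x)$ is $a(x)\star H_k$, and its cardinality is the cardinality of the set $H_k=\{\alpha^{n-k}x^k+\alpha^n\mid\alpha\in R^\times\}$.
   Context: A finite chain ring $R$ is a finite commutative local ring with identity whose ideals are linearly ordered by inclusion; $R^\times$ is its group of units. For $0<k<n$, $B_k=\{b_1x^k+b_0\mid b_1,b_0\in R^\times\}\subset R[x]$, with coefficientwise product $(a_1x^k+a_0)\star(b_1x^k+b_0)=a_1b_1x^k+a_0b_0$; $a(x)\star H_k=\{a(x)\star h(x)\mid h(x)\in H_k\}$. Let $B=\bigsqcup_{0<k<n}B_k$. Two elements $a(x),b(x)\in B$ are $n$-equivalent if there exists $\alpha\in R^\times$ such that $f(x)\mapsto f(\alpha x)$ is a (well-defined) $R$-algebra isomorphism $R[x]/\langle x^n-a(x)\rangle\to R[x]/\langle x^n-b(x)\rangle$; this is an equivalence relation on $B$. *)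

(* Defs.v *)
From HB Require Import structures.
From mathcomp Require Import all_boot all_order all_algebra.
From mathcomp Require Import boolp classical_sets functions cardinality.

Set Implicit Arguments.
Unset Strict Implicit.
Unset Printing Implicit Defensive.

Import GRing.Theory.
Local Open Scope ring_scope.
Local Open Scope classical_set_scope.

Section FiniteChainRing.
Variable R : finComUnitRingType.

Definition is_ideal (I : set R) : Prop :=
  [/\ I 0,
      forall u v, I u -> I v -> I (u + v) &
      forall a u, I u -> I (a * u)].

Definition is_maximal_ideal (M : set R) : Prop :=
  [/\ is_ideal M, M <> setT &
      forall J, is_ideal J -> M `<=` J -> J = M \/ J = setT].

Definition is_local_ring : Prop := exists! M : set R, is_maximal_ideal M.

Definition is_finite_chain_ring : Prop :=
  is_local_ring /\
  forall I J : set R, is_ideal I -> is_ideal J -> I `<=` J \/ J `<=` I.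

End FiniteChainRing.

Section Binomials.
Variable R : finComUnitRingType.
Implicit Types (k n : nat) (a b : {poly R}).

Definition Bk k : set {poly R} :=
  [set p | exists b1 b0 : R,
    [/\ b1 \is a GRing.unit, b0 \is a GRing.unit &
        p = b1 *: 'X^k + b0%:P]].

(* For a fixed n, the union over 0 < k < n is disjoint as a union of subsets
   of R[x]: units of a nontrivial ring are nonzero, so k can be read off from
   the polynomial *)
Definition B n : set {poly R} := \bigcup_(k in [set k | (0 < k < n)%N]) Bk k.

(* The product of B_k, written on arbitrary polynomials: for k > 0, the
   coefficients of b1 x^k + b0 at k and 0 are b1 and b0. *)
Definition star k a b : {poly R} :=
  (a`_k * b`_k) *: 'X^k + (a`_0 * b`_0)%:P.

Definition Hk n k : set {poly R} :=
  [set p | exists2 alpha : R, alpha \is a GRing.unit &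
    p = alpha ^+ (n - k) *: 'X^k + (alpha ^+ n)%:P].

Definition star_set k a (S : set {poly R}) : set {poly R} :=
  [set star k a h | h in S].

(* R[x]/<x^n - a(x)>: {poly %/ p} is the quotient by p when p is monic of
   degree at least 1 (and by 'X otherwise); mk_monic_B below shows that it is
   the intended quotient for every a in B n *)
Definition quot_ring n a := {poly %/ ('X^n - a)}.

(* f(x) |-> f(alpha x) is well defined on the quotients exactly when some map
   phi between them sends the class of f(x) to the class of f(alpha x) for
   every f; phi is then unique *)
Definition n_equiv n a b : Prop :=
  exists2 alpha : R, alpha \is a GRing.unit &
    exists phi : {lrmorphism quot_ring n a -> quot_ring n b},
      bijective phi /\
      forall f : {poly R},
        phi (in_qpoly ('X^n - a) f) =
        in_qpoly ('X^n - b) (f \Po (alpha *: 'X)).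

Definition n_class n a : set {poly R} := [set b | B n b /\ n_equiv n a b].

Lemma mk_monic_B n a : B n a -> mk_monic ('X^n - a) = 'X^n - a :> {poly R}.
Proof.
case=> k /= /andP[k0 kn] [b1 [b0 [_ _ ->]]].
have sa : (size (- (b1 *: 'X^k + b0%:P)) < size ('X^n : {poly R}))%N.
  rewrite size_polyN size_polyXn ltnS; apply: leq_trans (size_polyD _ _) _.
  rewrite geq_max (leq_trans (size_scale_leq _ _)) ?size_polyXn //=.
  exact: leq_trans (size_polyC_leq1 _) (leq_trans k0 (ltnW kn)).
rewrite /mk_monic size_polyDl // size_polyXn ltnS (leq_trans k0 (ltnW kn)) /=.
by rewrite ifT // monicE lead_coefDl // lead_coefXn.
Qed.

End Binomials.

Arguments Bk R k : clear implicits.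
Arguments B R n : clear implicits.
Arguments Hk R n k : clear implicits.

(* Main.v *)
(** The substitution x |-> alpha x descends to R[x]/<x^n - a> -> R[x]/<x^n - b>
    exactly when x^n - b divides alpha^n x^n - a(alpha x); as a and b have
    degree less than n, this means alpha^n b(x) = a(alpha x), i.e. b is the
    product of a and alpha^(k-n) x^k + alpha^(-n).  Multiplication by a is
    injective because the two coefficients of a are units. *)
Require Import Defs.
From HB Require Import structures.
From mathcomp Require Import all_boot all_order all_algebra.
From mathcomp Require Import boolp classical_sets functions cardinality.

Import GRing.Theory.
Local Open Scope classical_set_scope.
Local Open Scope card_scope.

Section QpolySubst.
Local Open Scope ring_scope.

Lemma in_qpolyK (R : nzRingType) (p : {poly R}) (x : {poly %/ p}) :
  in_qpoly p x = x.
Proof. exact/val_inj/in_qpoly_small/size_mk_monic. Qed.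

Variables (R : comNzRingType) (p q s : {poly R}).

(** Substitution is applied to the reduced representative. The proof is an argument of the function
    so that the morphism structures, valid only under this condition, can be attached to it. *)
Definition qpoly_subst of in_qpoly q (mk_monic p \Po s) = 0 :=
  fun x : {poly %/ p} => in_qpoly q ((x : {poly R}) \Po s).

Hypothesis ps0 : in_qpoly q (mk_monic p \Po s) = 0.

(** Division by the monic modulus writes [f] as a multiple of it plus the reduced representative;
    after substitution the multiple vanishes modulo [q]. *)
Lemma qpoly_substE (f : {poly R}) :
  qpoly_subst ps0 (in_qpoly p f) = in_qpoly q (f \Po s).
Proof.
rewrite [in RHS](Pdiv.RingMonic.rdivp_eq (monic_mk_monic p) f).
by rewrite comp_polyD comp_polyM in_qpolyD in_qpolyM ps0 mulr0 add0r.
Qed.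

Lemma qpoly_subst_linear : linear (qpoly_subst ps0).
Proof.
by move=> c x y; rewrite /qpoly_subst comp_polyD comp_polyZ linearP.
Qed.

Lemma qpoly_subst_monoid_morphism : monoid_morphism (qpoly_subst ps0).
Proof.
split=> [|x y]; first by rewrite -in_qpoly1 qpoly_substE comp_polyC in_qpoly1.
rewrite -[x]in_qpolyK -[y]in_qpolyK -in_qpolyM !qpoly_substE.
by rewrite comp_polyM in_qpolyM.
Qed.

HB.instance Definition _ := GRing.isLinear.Build R {poly %/ p} {poly %/ q} _
  (qpoly_subst ps0) qpoly_subst_linear.
HB.instance Definition _ :=
  GRing.isMonoidMorphism.Build {poly %/ p} {poly %/ q} (qpoly_subst ps0)
    qpoly_subst_monoid_morphism.

Lemma qpoly_subst_lrmorphism :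
  exists phi : {lrmorphism {poly %/ p} -> {poly %/ q}},
    forall f, phi (in_qpoly p f) = in_qpoly q (f \Po s).
Proof. by exists (qpoly_subst ps0); exact: qpoly_substE. Qed.

End QpolySubst.

Section NEquivalence.
Variable R : finComUnitRingType.
Implicit Types (n k : nat) (a b : {poly R}) (c : R).
Local Open Scope ring_scope.

Lemma comp_binomial_scaleX k c (a1 a0 : R) :
  (a1 *: 'X^k + a0%:P) \Po (c *: 'X) = (a1 * c ^+ k) *: 'X^k + a0%:P.
Proof.
by rewrite comp_polyD comp_polyC comp_polyZ comp_Xn_poly exprZn scalerA.
Qed.

Lemma comp_scaleXK c a : c \is a GRing.unit ->
  (a \Po (c *: 'X)) \Po (c^-1 *: 'X) = a.
Proof.
move=> cU; rewrite -comp_polyA comp_polyZ comp_polyX scalerA divrr //.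
by rewrite scale1r comp_polyXr.
Qed.

Lemma size_B n a : B R n a -> (size a <= n)%N.
Proof.
case=> k /= /andP[k0 kn] [b1 [b0 [_ _ ->]]].
apply: leq_trans (size_polyD _ _) _.
rewrite geq_max (leq_trans (size_scale_leq _ _)) ?size_polyXn //=.
exact: leq_trans (size_polyC_leq1 _) (leq_trans k0 (ltnW kn)).
Qed.

Lemma in_qpoly_XnBK n b : B R n b -> in_qpoly ('X^n - b) ('X^n - b) = 0.
Proof.
move=> Bb; apply: val_inj => /=; have := monic_mk_monic ('X^n - b).
by rewrite mk_monic_B //; exact: Pdiv.RingMonic.rmodpp.
Qed.

Lemma n_equivP n a b : B R n a -> B R n b ->
  n_equiv n a b <->
  exists2 c, c \is a GRing.unit & c ^+ n *: b = a \Po (c *: 'X).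
Proof.
move=> Ba Bb; split=> [[c cU [phi [_ phiE]]]|[c cU cb]]; exists c => //.
(* The class of $x^n - a$ is zero, so its image, the class of $c^n x^n - a(cx)$, is zero modulo $x^n
   - b$. *)
- have := phiE ('X^n - a); rewrite in_qpoly_XnBK // raddf0.
  rewrite comp_polyB comp_Xn_poly exprZn.
  have -> : c ^+ n *: 'X^n - (a \Po (c *: 'X)) =
      c ^+ n *: ('X^n - b) + (c ^+ n *: b - (a \Po (c *: 'X))).
    by rewrite scalerBr addrA subrK.
  rewrite in_qpolyD in_qpolyZ in_qpoly_XnBK // scaler0 add0r.
  move=> in0; apply/eqP; rewrite -subr_eq0.
  (* What remains has size at most $n$, below the size $n+1$ of the modulus, so it is its own
     reduced representative and must be the zero polynomial. *)
  rewrite -[X in X == _](@in_qpoly_small _ ('X^n - b)) -?in0 //.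
  (* This serves the final bound [(size a).-1 < n] in the case [size a = 0], where the predecessor
     truncates to 0. *)
  have n0 : (0 < n)%N by case: Ba => k /= /andP[_] /(leq_trans _) ->.
  rewrite mk_monic_B // [ltnRHS]size_polyDl size_polyXn ltnS; last first.
    by rewrite size_polyN size_B.
  apply: leq_trans (size_polyD _ _) _; rewrite size_polyN geq_max.
  rewrite (leq_trans (size_scale_leq _ _) (size_B _ _ Bb)) /=.
  apply: leq_trans (size_comp_poly_leq _ _) _.
  have sX : ((size (c *: 'X)).-1 <= 1)%N.
    rewrite -subn1 leq_subLR (leq_trans (size_scale_leq _ _)) //.
    by rewrite size_polyX.
  rewrite (leq_ltn_trans (leq_mul (leqnn _) sX)) // muln1.
  by case: (size a) (size_B _ _ Ba).
(* The relation makes $x^n - u$ go to $d^n (x^n - v)$. Stated for arbitrary [u], [v], [d], it gives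
   both the map and its inverse. *)
- have subst0 u v d : B R n u -> B R n v -> d ^+ n *: v = u \Po (d *: 'X) ->
      in_qpoly ('X^n - v) (mk_monic ('X^n - u) \Po (d *: 'X)) = 0.
    move=> Bu Bv dv; rewrite mk_monic_B // comp_polyB comp_Xn_poly exprZn -dv.
    by rewrite -scalerBr in_qpolyZ in_qpoly_XnBK // scaler0.
  (* Substituting $c^{-1}x$ in the given relation yields the symmetric one, hence a map back that
     undoes the substitution on every class. *)
  have cVa : c^-1 ^+ n *: a = b \Po (c^-1 *: 'X).
    rewrite -[a](comp_scaleXK _ _ cU) -cb comp_polyZ scalerA -exprMn mulVr //.
    by rewrite expr1n scale1r.
  have [phi phiE] := qpoly_subst_lrmorphism _ _ _ _ (subst0 _ _ _ Ba Bb cb).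
  have [psi psiE] := qpoly_subst_lrmorphism _ _ _ _ (subst0 _ _ _ Bb Ba cVa).
  exists phi; split=> //; exists psi => x; rewrite -[x]in_qpolyK.
    by rewrite phiE psiE comp_scaleXK.
  by rewrite psiE phiE -{1}[c]invrK comp_scaleXK ?unitrV.
Qed.

Lemma star_binomial k (a1 a0 b1 b0 : R) : (0 < k)%N ->
  star k (a1 *: 'X^k + a0%:P) (b1 *: 'X^k + b0%:P) =
  (a1 * b1) *: 'X^k + (a0 * b0)%:P.
Proof.
case: k => // k _; rewrite /star !(coefD, coefZ, coefC, coefXn) eqxx /=.
by rewrite !(mulr1, mulr0, addr0, add0r).
Qed.

Lemma star_inj k a b b' : (0 < k)%N -> Bk R k a -> Bk R k b -> Bk R k b' ->
  star k a b = star k a b' -> b = b'.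
Proof.
move=> k0 [a1 [a0 [a1U a0U ->]]] [b1 [b0 [_ _ ->]]] [b1' [b0' [_ _ ->]]].
rewrite !star_binomial // => /polyP eq_ab.
have := eq_ab 0%N; have := eq_ab k.
rewrite !(coefD, coefZ, coefC, coefXn) eqxx gtn_eqF // ltn_eqF //=.
rewrite !(mulr1, mulr0, addr0, add0r).
by move=> /(mulrI a1U)-> /(mulrI a0U)->.
Qed.

Lemma Hk_Bk n k : Hk R n k `<=` Bk R k.
Proof.
move=> _ [c cU ->]; exists (c ^+ (n - k)), (c ^+ n).
by split; rewrite ?unitrX.
Qed.

Lemma Bk_star k a b : (0 < k)%N -> Bk R k a -> Bk R k b -> Bk R k (star k a b).
Proof.
move=> k0 [a1 [a0 [a1U a0U ->]]] [b1 [b0 [b1U b0U ->]]].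
by exists (a1 * b1), (a0 * b0); rewrite star_binomial // !unitrM a1U a0U b1U.
Qed.

Lemma star_HkE n k a b c : (0 < k < n)%N -> Bk R k a -> c \is a GRing.unit ->
  star k a (c^-1 ^+ (n - k) *: 'X^k + (c^-1 ^+ n)%:P) = b <->
  c ^+ n *: b = a \Po (c *: 'X).
Proof.
move=> /andP[k0 kn] [a1 [a0 [_ _ ->]]] cU.
rewrite star_binomial // comp_binomial_scaleX.
have cnU : c ^+ n \is a GRing.unit by rewrite unitrX.
(* Here $c^n c^{-(n-k)} = c^k$ and $c^n c^{-n} = 1$. Since $c^n$ is a unit, the scaling can be
   cancelled in the converse. *)
have cK : c ^+ n *: ((a1 * c^-1 ^+ (n - k)) *: 'X^k + (a0 * c^-1 ^+ n)%:P) =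
    (a1 * c ^+ k) *: 'X^k + a0%:P.
  rewrite scalerDr scalerA mulrCA -{1}(subnKC (ltnW kn)) exprD -mulrA.
  rewrite -exprMn divrr // expr1n mulr1; congr (_ + _).
  by rewrite -mul_polyC -polyCM mulrCA -exprMn divrr // expr1n mulr1.
split=> [<- //|]; rewrite -cK => /(congr1 ( *:%R (c ^+ n)^-1)).
by rewrite !scalerA mulVr // !scale1r.
Qed.

End NEquivalence.

Theorem corollary3 (R : finComUnitRingType) (n k : nat) (a : {poly R}) :
  is_finite_chain_ring R -> (0 < k < n)%N -> Bk R k a ->
  n_class n a = star_set k a (Hk R n k) /\ n_class n a #= Hk R n k.
Proof.
move=> _ kn Ba.
have k0 : (0 < k)%N by case/andP: kn.
have BkB (b : {poly R}) : Bk R k b -> B R n b by exists k.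
suff cl : n_class n a = star_set k a (Hk R n k).
  (* The class is the image of [Hk R n k] under [star k a], which is injective on [Bk R k] and so on
     this subset. *)
  split; rewrite // cl; apply: inj_card_eq => b b' /set_mem Hb /set_mem Hb'.
  by apply: star_inj => //; apply: Hk_Bk; eassumption.
apply/seteqP; split=> [b [Bb /n_equivP[|//|c cU cb]]|_ [h Hh <-]].
- exact: BkB.
- exists (c^-1 ^+ (n - k) *: 'X^k + (c^-1 ^+ n)%:P)%R; last exact/star_HkE.
  by exists (c^-1)%R; rewrite ?unitrV.
- have Bah : B R n (star k a h) by apply/BkB/Bk_star => //; exact: Hk_Bk Hh.
  split=> //; apply/n_equivP => //; first exact: BkB.
  (* The unit defining the element of [Hk R n k] is the inverse of the substitution factor. *)
  case: Hh => c cU ->; exists (c^-1)%R; rewrite ?unitrV //.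
  have cVU : (c^-1 \is a GRing.unit)%R by rewrite unitrV.
  by apply/(star_HkE R n k a _ _ kn Ba cVU); rewrite invrK.
Qed.
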